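(* Let $s,t\geq 1$ be integers and let $p,q,l$ be three distinct primes with $p,q$ odd, $p\equiv 3 \pmod 4$, $\mathrm{ord}_{p^s}(l)=\phi(p^s)/2$, $\mathrm{ord}_{q^t}(l)=\phi(q^t)$ and $\gcd(\phi(p^s),\phi(q^t))=2$. Let $0\leq i\leq s-1$ and $0\leq j<j'\leq t$. Then in the ring $\mathbb{F}_l[x]/\langle x^{p^sq^t}-1\rangle$: (i) If $q$ is a quadratic residue modulo $p$, then \[\chi_{ij}\chi_{ij'}=\frac{p-3}{4}p^{s-i-1}\phi(q^{t-j'})\chi_{ij}+\frac{p+1}{4}p^{s-i-1}\phi(q^{t-j'})\chi_{ij}^*.\] (ii) If $q$ is a quadratic nonresidue modulo $p$ and $2\mid j'-j$, then \[\chi_{ij}\chi_{ij'}=\frac{p-3}{4}p^{s-i-1}\phi(q^{t-j'})\chi_{ij}+\frac{p+1}{4}p^{s-i-1}\phi(q^{t-j'})\chi_{ij}^*.\] (iii) If $q$ is a quadratic nonresidue modulo $p$ and $2\nmid j'-j$, then \[\chi_{ij}\chi_{ij'}=\frac{p-3}{4}p^{s-i-1}\phi(q^{t-j'})(\chi_{ij}+\chi_{ij}^* )+\frac{\phi(p^{s-i})}{2}\phi(q^{t-j'})\Big(\sum_{i< k\leq s-1}(\chi_{kj}+\chi_{kj}^* )+\chi_{sj}\Big).\]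
   Context: Here $\phi$ is Euler's phi function (with $\phi(1)=1$) and $\mathrm{ord}_m(k)$ is the multiplicative order of $k$ modulo $m$. Put $n=p^sq^t$. Fix an integer $g$ that is a primitive root both modulo $p^s$ and modulo $q^t$. For an integer $\gamma$, $C_\gamma=\{\gamma l^r \bmod n: r\geq 0\}\subseteq \mathbb{Z}_n$ is the $l$-cyclotomic coset modulo $n$ containing $\gamma$. For $0\leq i\leq s$, $0\leq j\leq t$ set $C_{ij}=C_{p^iq^j}$ and $C_{ij}^*=C_{p^iq^jg}$; in particular $C_{sj}=C_{sj}^*$ and $C_{st}=C_0=\{0\}$. Define elements of $\mathbb{F}_l[x]/\langle x^{n}-1\rangle$ by $\chi_{ij}=\sum_{\alpha\in C_{ij}}x^\alpha$ and $\chi_{ij}^*=\sum_{\alpha\in C_{ij}^*}x^\alpha$; in particular $\chi_{sj}=\chi_{sj}^*$ and $\chi_{st}=1$. Integer coefficients are read in $\mathbb{F}_l$, and empty sums are $0$. *)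

(* Defs.v *)
From mathcomp Require Import all_boot all_order all_algebra all_fingroup.
From mathcomp Require Import qpoly.

Set Implicit Arguments.
Unset Strict Implicit.
Unset Printing Implicit Defensive.

Import GRing.Theory.
Local Open Scope ring_scope.

(* ['Z_m] is the ring of integers modulo [m] only for [1 < m]; below it is used
   only at moduli p ^ s, q ^ t and p ^ s * q ^ t with p, q primes, s, t >= 1. *)

(* Order of [k] in the unit group of Z/m; 0 if [k] is not invertible mod [m]. *)
Definition mult_ord (m : nat) (k : int) : nat :=
  if insub (k%:~R : 'Z_m) is Some u then #[u : {unit 'Z_m}]%g else 0%N.

(* This forces [g] to be coprime to [m], since [totient m] is positive
   for [0 < m]. *)
Definition primitive_root_mod (m : nat) (g : int) : Prop :=
  mult_ord m g = totient m.

Definition quad_residue (p a : nat) : Prop :=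
  coprime a p /\ exists x : nat, (x ^ 2 = a %[mod p])%N.

Definition quad_nonresidue (p a : nat) : Prop :=
  coprime a p /\ ~ exists x : nat, (x ^ 2 = a %[mod p])%N.

(* [fconnect f x y] says that y is an iterate of f at x; see [cyc_cosetP]. *)
Definition cyc_coset (l n : nat) (gamma : int) : {set 'Z_n} :=
  [set a | fconnect (fun y : 'Z_n => y * l%:R) gamma%:~R a].

Lemma cyc_cosetP (l n : nat) (gamma : int) (a : 'Z_n) :
  reflect (exists r : nat, a = (gamma * l%:Z ^+ r)%:~R)
          (a \in cyc_coset l n gamma).
Proof.
have iterE r : iter r (fun y : 'Z_n => y * l%:R) gamma%:~R
             = (gamma * l%:Z ^+ r)%:~R.
  elim: r => [|r IHr]; first by rewrite expr0 mulr1.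
  by rewrite iterS IHr exprSr mulrA [in RHS]intrM.
rewrite inE; apply: (iffP idP) => [/iter_findex <-|[r ->]].
  by eexists; apply: iterE.
by rewrite -iterE fconnect_iter.
Qed.

(* [{poly %/ h}] is the quotient by [h] when [h] is monic of positive degree,
   hence for [h = 'X^n - 1] with [0 < n]. *)
Notation cyc_ring l n := {poly %/ ('X^n - 1 : {poly 'F_l})}.

Lemma cyc_ring_modulus (l n : nat) :
  (0 < n)%N -> mk_monic ('X^n - 1 : {poly 'F_l}) = 'X^n - 1.
Proof.
by move=> n0; rewrite /mk_monic size_XnsubC // ltnS n0 monicXnsubC.
Qed.

(* The exponent is the representative of the residue class in [0, n). *)
Definition coset_sum (l n : nat) (gamma : int) : cyc_ring l n :=
  \sum_(a in cyc_coset l n gamma) ('qX : cyc_ring l n) ^+ (a : nat).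

Definition chi (p q l s t i j : nat) : cyc_ring l (p ^ s * q ^ t) :=
  coset_sum l (p ^ s * q ^ t) (p ^ i * q ^ j)%N%:Z.

Definition chi_star (p q l s t : nat) (g : int) (i j : nat) :
    cyc_ring l (p ^ s * q ^ t) :=
  coset_sum l (p ^ s * q ^ t) ((p ^ i * q ^ j)%N%:Z * g).

(* Main.v *)
(* By the Chinese remainder theorem and the conditions on the orders, the powers
   of l are exactly the pairs (square unit mod p^s, unit mod q^t).  Hence, for
   i < s, membership of c in C_ij splits into p^i | c, a quadratic character
   condition on c / p^i mod p, and gcd(c, q^t) = q^j.  The coefficient of x^c in
   chi_ij chi_ij' therefore factors as a count mod q^t, which is
   phi(q^(t-j')), times p^(s-i-1) times a number of solutions of x + y = c / p^i
   in F_p with x and y in prescribed quadratic classes; the latter is the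
   classical cyclotomic number of order 2 for p = 4k + 3. *)

Require Import Defs.
From mathcomp Require Import all_boot all_order all_algebra all_fingroup.
From mathcomp Require Import all_solvable all_field.
From mathcomp Require Import qpoly.
From mathcomp Require Import zify ring.

Set Implicit Arguments.
Unset Strict Implicit.
Unset Printing Implicit Defensive.

Import GRing.Theory.
Local Open Scope ring_scope.

(** * Quadratic classes in a finite field with [4 * k + 3] elements *)

Section QuadraticCharacter.
Variables (F : finFieldType) (k : nat).
Hypothesis cardF : #|F| = (4 * k + 3)%N.

(* Euler's criterion taken as the definition of a nonzero square. *)
Definition is_res (x : F) : bool := x ^+ #|F|./2 == 1.

Arguments is_res x%_R.

Let halfF : #|F|./2 = (2 * k).+1.
Proof. by rewrite cardF; lia. Qed.

Lemma is_res0 : is_res 0 = false.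
Proof. by rewrite /is_res halfF exprS mul0r eq_sym oner_eq0. Qed.

Lemma is_resMl x y : is_res x -> is_res (x * y) = is_res y.
Proof. by rewrite /is_res exprMn => /eqP->; rewrite mul1r. Qed.

Lemma is_resMlN x y : is_res (- x) -> is_res (x * y) = is_res (- y).
Proof. by move=> rx; rewrite -mulrNN is_resMl. Qed.

Lemma is_res_neq0 x : is_res x -> x != 0.
Proof. by apply: contraTneq => ->; rewrite is_res0. Qed.

Lemma is_resV x : is_res x^-1 = is_res x.
Proof. by rewrite /is_res exprVn invr_eq1. Qed.

(** If 1 = -1, the additive order of 1 divides both 2 and the odd number [#|F|], so 1 = 0. *)
Lemma oner_neqN1 : 1 != -1 :> F.
Proof.
apply/eqP => e.
have dvd2 : (#[1%R : F]%g %| 2)%N.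
  by rewrite order_dvdn FinRing.zmodXgE mulr2n [X in _ + X]e subrr.
have dvdF : (#[1%R : F]%g %| #|F|)%N by rewrite -cardsT order_dvdG ?inE.
have : (#[1%R : F]%g %| 1)%N.
  have <- : gcdn 2 #|F| = 1%N.
    by apply/eqP; rewrite -/(coprime _ _) coprime2n cardF; lia.
  by rewrite dvdn_gcd dvd2.
by rewrite order_dvdn expg1 FinRing.zmod1gE oner_eq0.
Qed.

(** Cancelling x in x^|F| = x shows that x^(2k+1) squares to 1, hence is 1 or -1; as 2k+1 is odd,
    negating x swaps the two values. *)
Lemma is_resN x : x != 0 -> is_res (- x) = ~~ is_res x.
Proof.
move=> x0; have : x ^+ #|F|./2 ^+ 2 == 1.
  have : x * x ^+ (#|F|./2 * 2) = x * 1.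
    by rewrite -exprS mulr1 -[RHS]expf_card; congr (_ ^+ _); lia.
  by move/(mulfI x0); rewrite exprM => ->.
have -> : is_res (- x) = (x ^+ #|F|./2 == -1).
  rewrite /is_res exprNn halfF -signr_odd /= oddM /= expr1 mulN1r.
  by rewrite -eqr_opp opprK.
rewrite sqrf_eq1 /is_res; case: eqP => [->|_] /=; last by move->.
by rewrite (negPf oner_neqN1).
Qed.

Lemma is_res_sign x : (is_res x + is_res (- x) = (x != 0%R))%N.
Proof.
have [->|x0] := eqVneq x 0; first by rewrite oppr0 is_res0.
by rewrite is_resN //; case: is_res.
Qed.

Lemma is_res_sqr x : x != 0 -> is_res (x * x).
Proof.
move=> x0; case rx: (is_res x); first by rewrite is_resMl.
by rewrite -mulrNN is_resMl is_resN ?rx.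
Qed.

Lemma is_res1 : is_res 1.
Proof. by rewrite /is_res expr1n. Qed.

Lemma is_resN1 : is_res (-1) = false.
Proof. by rewrite is_resN ?oner_eq0 // is_res1. Qed.

(** Negation exchanges residues and nonresidues among the 4k+2 nonzero elements. *)
Lemma sum_is_res : (\sum_(x : F) is_res x = 2 * k + 1)%N.
Proof.
have: (\sum_(x : F) is_res x + \sum_(x : F) is_res (- x) = 4 * k + 2)%N.
  rewrite -big_split /= (eq_bigr _ (fun x _ => is_res_sign x)) -big_mkcond sum1_card.
  by rewrite (cardC1 (0 : F)) cardF; lia.
rewrite [X in (_ + X)%N](reindex_inj oppr_inj) /=.
have -> : (\sum_(x : F) is_res (- - x) = \sum_(x : F) is_res x)%N.
  by apply: eq_bigr => x _; rewrite opprK.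
by rewrite addnn; lia.
Qed.

(* The substitution x -> 1/x matches the solutions of [is_res (1 - x)] with
   those of [is_res (x - 1)]. *)
Lemma sum_res_res : (\sum_(x : F) (is_res x && is_res (1 - x)) = k)%N.
Proof.
suff: (\sum_(x : F) (is_res x && is_res (1 - x)) +
       \sum_(x : F) (is_res x && is_res (1 - x)) = 2 * k)%N by lia.
rewrite {2}(reindex_inj invr_inj) /=.
have -> : (\sum_(x : F) (is_res x^-1 && is_res (1 - x^-1)) =
           \sum_(x : F) (is_res x && is_res (- (1 - x))))%N.
  apply: eq_bigr => x _; rewrite is_resV; case rx: (is_res x) => //=.
  rewrite -(is_resMl _ rx) mulrBr mulr1 divff ?is_res_neq0 // opprB.
  by [].
(* Each residue x other than 1 is counted exactly once, through 1 - x or x - 1. Adding 1 to both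
   sides restores the residue x = 1, so the total compares with [sum_is_res]. *)
rewrite -big_split /=; apply: succn_inj.
rewrite -[RHS]addn1 -sum_is_res [RHS](bigD1 1) //= is_res1 [in LHS](bigD1 1) //=.
rewrite subrr oppr0 is_res0 !andbF !add0n add1n; congr _.+1.
apply: eq_bigr => x x1; case: is_res => //=.
by rewrite is_res_sign subr_eq0 eq_sym x1.
Qed.

(** Complement of [sum_res_res]: the 2k residues x other than 1 divide according to the sign for
    which 1 - x is a residue. *)
Lemma sum_res_nonres : (\sum_(x : F) (is_res x && is_res (x - 1)) = k)%N.
Proof.
apply/eqP; rewrite -(eqn_add2l k) -{1}sum_res_res -big_split /=; apply/eqP.
apply: succn_inj.
rewrite -[X in _ = X]addn1 addnn -mul2n -sum_is_res [RHS](bigD1 1) //= is_res1.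
rewrite [in LHS](bigD1 1) //= subrr is_res0 !andbF !add0n add1n; congr _.+1.
apply: eq_bigr => x x1; case: is_res => //=.
by rewrite -(opprB 1 x) is_res_sign subr_eq0 eq_sym x1.
Qed.

(** Among the 2k+1 elements x with x - 1 a residue, none is 0 because -1 is a nonresidue; k of them
    are residues, and the others are counted here. *)
Lemma sum_nonres_nonres : (\sum_(x : F) (is_res (- x) && is_res (x - 1)) = k + 1)%N.
Proof.
apply/eqP; rewrite -(eqn_add2l k) -{1}sum_res_nonres -big_split /=; apply/eqP.
have -> : (k + (k + 1) = 2 * k + 1)%N by lia.
rewrite -sum_is_res [RHS](reindex_inj (addIr (-1))) /=.
apply: eq_bigr => x _; case rx: (is_res (x - 1)); last by rewrite !andbF.
rewrite !andbT is_res_sign; suff -> : x != 0 by [].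
by apply: contraTneq rx => ->; rewrite sub0r is_resN1.
Qed.

(** The substitution x -> c x reduces to c = 1 when c is a residue and reverses both characters
    otherwise. For c = 0 nothing is counted, since x and -x are never both residues. *)
Lemma sum_res_split (c : F) :
  (\sum_(x : F) (is_res x && is_res (c - x)) =
   k * is_res c + (k + 1) * is_res (- c))%N.
Proof.
have [->|c0] := eqVneq c 0.
  rewrite oppr0 is_res0 !muln0 big1 // => x _; rewrite sub0r.
  case rx: (is_res x) => //=.
  by rewrite is_resN ?rx ?is_res_neq0.
rewrite (reindex_inj (mulfI c0)) /=; rewrite is_resN //.
case rc: (is_res c); rewrite ?muln0 ?muln1 ?add0n ?addn0.
  rewrite -[RHS]sum_res_res; apply: eq_bigr => x _.
  by rewrite -[X in X - _]mulr1 -mulrBr !is_resMl.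
rewrite -[RHS]sum_nonres_nonres; apply: eq_bigr => x _.
have rNc : is_res (- c) by rewrite is_resN ?rc.
by rewrite -[X in X - _]mulr1 -mulrBr !is_resMlN // opprB.
Qed.

Lemma sum_res_nonres_split (c : F) :
  (\sum_(x : F) (is_res x && is_res (x - c)) =
   k * (c != 0%R) + (2 * k + 1) * (c == 0%R))%N.
Proof.
have [->|c0] := eqVneq c 0.
  rewrite muln0 muln1 -sum_is_res; apply: eq_bigr => x _.
  by rewrite subr0 andbb.
rewrite (reindex_inj (mulfI c0)) /= muln0 muln1 addn0 -[RHS]sum_res_nonres.
case rc: (is_res c).
  by apply: eq_bigr => x _; rewrite -[X in _ - X]mulr1 -mulrBr !is_resMl.
have rNc : is_res (- c) by rewrite is_resN ?rc.
(* For a nonresidue c both characters are reversed; x -> 1 - x exchanges the two resulting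
   conditions. *)
rewrite [RHS](reindex_inj (can_inj (subKr 1))) /=; apply: eq_bigr => x _.
rewrite -[X in _ - X]mulr1 -mulrBr !is_resMlN // opprB andbC.
by congr (_ && is_res _); rewrite addrAC subrr add0r.
Qed.

(** Here u and v lie in the same class, so v x may be replaced by u x, and x -> u x leads to
    [sum_res_split] at u c. *)
Lemma sum_res_same (u v c : F) : is_res (u * v) ->
  (\sum_(x : F) (is_res (v * x) && is_res (u * (c - x))) =
   k * is_res (u * c) + (k + 1) * is_res (- (u * c)))%N.
Proof.
move=> ruv; have u0 : u != 0.
  by apply: contraTneq ruv => ->; rewrite mul0r is_res0.
rewrite -sum_res_split [RHS](reindex_inj (mulfI u0)) /=.
apply: eq_bigr => x _; rewrite mulrBr; congr (_ && _).
by rewrite -(is_resMl _ (is_res_sqr u0)) mulrACA is_resMl.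
Qed.

(** Here v lies in the class of -u, so x -> -u x leads to [sum_res_nonres_split] at -u c. *)
Lemma sum_res_opp (u v c : F) : is_res (- (u * v)) ->
  (\sum_(x : F) (is_res (v * x) && is_res (u * (c - x))) =
   k * (c != 0%R) + (2 * k + 1) * (c == 0%R))%N.
Proof.
move=> ruv; have u0 : u != 0.
  by apply: contraTneq ruv => ->; rewrite mul0r oppr0 is_res0.
have uN0 : - u != 0 by rewrite oppr_eq0.
have -> : (c == 0) = (- u * c == 0) by rewrite mulf_eq0 (negPf uN0).
rewrite -sum_res_nonres_split [RHS](reindex_inj (mulfI uN0)) /=.
apply: eq_bigr => x _; rewrite -mulrBr -(opprB c x) mulrNN; congr (_ && _).
by rewrite -(is_resMl _ (is_res_sqr u0)) mulrACA is_resMlN // mulNr.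
Qed.

End QuadraticCharacter.
(** * Sums over residues *)

(** Cut into m blocks of length d, only the first element of each block is a multiple of d. *)
Lemma sum_nat_dvd (d m : nat) (F : nat -> nat) : (0 < d)%N ->
  (\sum_(0 <= x < m * d) (d %| x) * F (x %/ d) = \sum_(0 <= y < m) F y)%N.
Proof.
move=> d0; rewrite big_nat_mul; apply: eq_bigr => i _.
rewrite -[X in (\sum_(X <= _ < _) _)%N]add0n big_addn mulSn addnK big_mkord.
case: d d0 => // d _; rewrite big_ord_recl /= add0n dvdn_mull // mul1n mulnK //.
rewrite big1 ?addn0 // => x _; rewrite dvdn_addl ?dvdn_mull // gtnNdvd //.
by rewrite ltnS (ltn_ord x).
Qed.

Lemma sum_nat_mod (d m : nat) (F : nat -> nat) :
  (\sum_(0 <= x < m * d) F (x %% d) = m * \sum_(0 <= x < d) F x)%N.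
Proof.
rewrite big_nat_mul (eq_bigr (fun=> \sum_(0 <= x < d) F x)%N).
  by rewrite sum_nat_const_nat subn0.
move=> i _; rewrite -[X in (\sum_(X <= _ < _) _)%N]add0n big_addn mulSn addnK.
by rewrite !big_mkord; apply: eq_bigr => x _; rewrite addnC modnMDl modn_small.
Qed.

Lemma sum_nat_chinese (m1 m2 : nat) (F G : nat -> nat) : coprime m1 m2 ->
  (\sum_(0 <= x < m1 * m2) F (x %% m1) * G (x %% m2) =
   (\sum_(0 <= x < m1) F x) * \sum_(0 <= y < m2) G y)%N.
Proof.
move=> co; rewrite !big_mkord big_distrlr pair_big /=.
(* Positivity of the moduli comes from having an element x, so that no such hypothesis appears in
   the statement. *)
have pos (x : 'I_(m1 * m2)) : (0 < m1)%N && (0 < m2)%N.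
  by case: x => x /=; rewrite -muln_gt0; case: (m1 * m2)%N.
pose f (x : 'I_(m1 * m2)) :=
  (Ordinal (ltn_pmod x (proj1 (andP (pos x)))),
   Ordinal (ltn_pmod x (proj2 (andP (pos x))))).
have fI : injective f.
  move=> x y [e1 e2]; apply: val_inj => /=.
  rewrite -(modn_small (ltn_ord x)) -(modn_small (ltn_ord y)); apply/eqP.
  by rewrite chinese_remainder // e1 e2 !eqxx.
have fB : bijective f by apply: inj_card_bij => //; rewrite card_prod !card_ord.
by rewrite (reindex f) //; apply: onW_bij.
Qed.

(** Writing y = z q^j turns the gcd condition into coprimality of z with q^(t-j). *)
Lemma sum_nat_gcd (q t j : nat) : prime q -> (j <= t)%N ->
  (\sum_(0 <= y < q ^ t) (gcdn y (q ^ t) == q ^ j) = totient (q ^ (t - j)))%N.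
Proof.
move=> q_pr jt; have q0 := prime_gt0 q_pr.
rewrite totient_count_coprime -[X in (\sum_(0 <= _ < q ^ X) _)%N](subnK jt) expnD.
rewrite -[RHS](@sum_nat_dvd (q ^ j)%N) ?expn_gt0 ?q0 //.
apply: eq_bigr => y _; have [/dvdnP[z ->]|/negP ndv] := boolP (_ %| _)%N.
  rewrite mulnK ?expn_gt0 ?q0 // mul1n -{1}(subnK jt) expnD -muln_gcdl.
  by rewrite -{2}[(q ^ j)%N]mul1n eqn_pmul2r ?expn_gt0 ?q0 // coprime_sym.
by rewrite mul0n; case: eqP => // e; case: ndv; rewrite -e dvdn_gcdl.
Qed.

(** * Multiplicative orders *)

Lemma natr_Zp_eq (M a b : nat) : (1 < M)%N ->
  (a%:R == b%:R :> 'Z_M) = (a == b %[mod M]).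
Proof. by move=> M1; rewrite -val_eqE /= !val_Zp_nat. Qed.

Section MultOrd.
Variables (M k : nat).
Hypotheses (M1 : (1 < M)%N) (ord_k : (0 < mult_ord M k%:Z)%N).

Lemma mult_ord_unit :
  exists2 u : {unit 'Z_M}, val u = k%:R & #[u]%g = mult_ord M k%:Z.
Proof.
by move: ord_k; rewrite /mult_ord; case: insubP => // u _ uE _; exists u.
Qed.

Lemma mult_ord_coprime : coprime k M.
Proof.
have [u uE _] := mult_ord_unit.
by rewrite coprime_sym -unitZpE // -uE; apply: valP.
Qed.

Lemma mult_ord_dvd e : (k ^ e == 1 %[mod M])%N = (mult_ord M k%:Z %| e)%N.
Proof.
have [u uE <-] := mult_ord_unit.
rewrite -natr_Zp_eq // natrX -uE -FinRing.val_unitX order_dvdn.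
exact: (inj_eq val_inj (u ^+ e)%g 1%g).
Qed.

(** The primitive root makes the unit group cyclic, and subgroups of a cyclic group are ordered by
    divisibility of their orders. Hence the subgroup generated by a lies in the one generated by
    k. *)
Lemma mult_ord_expn (g : int) (a : nat) : primitive_root_mod M g ->
  a ^ mult_ord M k%:Z = 1 %[mod M] -> exists r, k ^ r = a %[mod M].
Proof.
move=> g_prim aM; have [u uE uo] := mult_ord_unit.
have M0 := ltnW M1.
have cyc : cyclic (units_Zp M).
  have : (0 < mult_ord M g)%N by rewrite g_prim totient_gt0.
  move: g_prim; rewrite /primitive_root_mod /mult_ord.
  case: insubP => // v _ _ ov _; apply/cyclicP; exists v.
  by apply/eqP; rewrite eq_sym eqEcard subsetT card_units_Zp // -ov leqnn.
have a1 : (a%:R : 'Z_M) ^+ mult_ord M k%:Z = 1.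
  by apply/eqP; rewrite -natrX -[1]/(1%:R) natr_Zp_eq // aM.
have ua : (a%:R : 'Z_M) \is a GRing.unit.
  by rewrite -(@unitrX_pos _ _ (mult_ord M k%:Z)) // a1 unitr1.
have : FinRing.unit 'Z_M ua \in <[u]>%g.
  rewrite -cycle_subG -(cardSg_cyclic cyc) ?subsetT // -!orderE uo.
  by rewrite order_dvdn -(inj_eq val_inj) FinRing.val_unitX /= a1.
case/cycleP => r /(congr1 val); rewrite FinRing.val_unitX uE /= -natrX.
by move/eqP; rewrite natr_Zp_eq // => /eqP ->; exists r.
Qed.

End MultOrd.
Lemma intr_modz (M n : nat) (g : int) : (M %| n)%N -> (1 < M)%N ->
  (g %% n)%Z%:~R = g%:~R :> 'Z_M.
Proof.
move=> /dvdnP[d nE] M1; rewrite [in RHS](divz_eq g n) [RHS]intrD.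
rewrite [X in _ = X + _]intrM.
suff -> : (n%:Z)%:~R = 0 :> 'Z_M by rewrite mulr0 add0r.
by apply/eqP; rewrite -[0]/(0%:R) natr_Zp_eq // nE modnMl mod0n.
Qed.

Lemma mult_ord_modz (M n : nat) (g : int) : (M %| n)%N -> (1 < M)%N ->
  mult_ord M (g %% n)%Z = mult_ord M g.
Proof. by move=> Mn M1; rewrite /mult_ord intr_modz. Qed.

(** The solution is given as a whole class of exponents modulo the order of k, so that the exponents
    for two moduli can later be merged by the Chinese remainder theorem. *)
Lemma mult_ord_solve (M k z c : nat) (g : int) :
    (1 < M)%N -> (0 < mult_ord M k%:Z)%N -> primitive_root_mod M g ->
    coprime z M ->
    (forall y, z * y = c %[mod M] -> y ^ mult_ord M k%:Z = 1 %[mod M]) ->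
  exists r0, forall r, r = r0 %[mod mult_ord M k%:Z] ->
    z * k ^ r = c %[mod M].
Proof.
move=> M1 ord_k g_prim z_co sol; set m := mult_ord M _ in ord_k sol *.
(* By Euler's theorem, z^(phi(M)-1) inverts z modulo M. *)
pose y := (z ^ (totient M).-1 * c)%N.
have zy : z * y = c %[mod M].
  rewrite /y mulnA -expnS prednK ?totient_gt0 ?(ltnW M1) //.
  by rewrite -modnMml Euler_exp_totient // modnMml mul1n.
have [r0 kr0] := mult_ord_expn M1 ord_k g_prim (sol _ zy).
have k_m r : k ^ r = k ^ (r %% m) %[mod M].
  have /eqP km : k ^ m == 1 %[mod M] by rewrite mult_ord_dvd.
  rewrite {1}(divn_eq r m) expnD (mulnC _ m) expnM -modnMml -modnXm km.
  by rewrite modnXm exp1n modnMml mul1n.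
exists r0 => r rr0; rewrite -modnMmr k_m rr0 -k_m kr0 modnMmr.
exact: zy.
Qed.

Lemma gcdn_pfactor_eq (q t j x : nat) : prime q -> (j < t)%N ->
  (gcdn x (q ^ t) == q ^ j)%N = (q ^ j %| x)%N && ~~ (q ^ j.+1 %| x)%N.
Proof.
move=> q_pr jt; have q1 := prime_gt1 q_pr; apply/eqP/andP.
  move=> e; split; first by rewrite -e dvdn_gcdl.
  apply/negP => d; have : (q ^ j.+1 %| q ^ j)%N.
    by rewrite -e dvdn_gcd d dvdn_exp2l.
  by rewrite dvdn_Pexp2l // ltnn.
case=> d nd; have /(dvdn_pfactor _ _ q_pr)[e et E] := dvdn_gcdr x (q ^ t).
rewrite E; congr (_ ^ _)%N; apply/eqP; rewrite eqn_leq.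
have je : (j <= e)%N.
  by rewrite -(dvdn_Pexp2l _ _ q1) -E dvdn_gcd d dvdn_exp2l 1?ltnW.
rewrite je andbT leqNgt; apply: contra nd => je1.
by apply: dvdn_trans (dvdn_gcdl x (q ^ t)); rewrite E dvdn_exp2l.
Qed.
(** * Sums of powers of an n-th root of unity *)

Lemma qX_expn (l n : nat) : (1 < n)%N -> ('qX : cyc_ring l n) ^+ n = 1.
Proof.
move=> n1; rewrite /qpolyX -rmorphXn; apply/eqP; rewrite -subr_eq0.
rewrite -(rmorph1 (in_qpoly ('X^n - 1))) -rmorphB; apply/eqP. apply: val_inj.
change (Pdiv.CommonRing.rmodp ('X^n - 1) (mk_monic ('X^n - 1)) = 0 :> {poly 'F_l}).
rewrite cyc_ring_modulus ?(ltnW n1) ?Pdiv.CommonRing.rmodpp //; apply: mulrC.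
Qed.

Lemma expr_mod_val (R : pzRingType) (n : nat) (x : R) (a b : 'Z_n) :
  (1 < n)%N -> x ^+ n = 1 -> x ^+ a * x ^+ b = x ^+ (a + b)%R.
Proof.
move=> n1 xn; rewrite -exprD -(expr_mod _ xn) /=; congr (_ ^+ (_ %% _)%N).
by rewrite Zp_cast.
Qed.

(** Collecting terms by c = b + a makes the product a convolution; this reduces the theorem to
    counting. *)
Lemma mul_set_sums (R : comPzRingType) (n : nat) (x : R) (A B : {set 'Z_n}) :
  (1 < n)%N -> x ^+ n = 1 ->
  (\sum_(a in A) x ^+ a) * (\sum_(b in B) x ^+ b) =
  \sum_(c : 'Z_n) x ^+ c *+ (\sum_(b : 'Z_n) (b \in B) * (c - b \in A)%R)%N.
Proof.
move=> n1 xn; rewrite mulrC big_distrlr /=.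
under [RHS]eq_bigr do rewrite -sumrMnr.
rewrite [RHS]exchange_big /= [LHS]big_mkcond /=; apply: eq_bigr => b _.
have [bB|bB] := ifPn; last by rewrite big1 // => c _; rewrite mul0n.
rewrite big_mkcond [RHS](reindex_inj (addrI b)) /=; apply: eq_bigr => a _.
rewrite mul1n (addrC b) addrK; case: ifP => // _.
by rewrite mulr1n expr_mod_val // addrC.
Qed.

Lemma scale_sum_mulrn (R : pzRingType) (V : lmodType R) (I : finType)
    (e : I -> V) (m : I -> nat) (a : nat) :
  a%:R *: (\sum_(c : I) e c *+ m c) = \sum_(c : I) e c *+ (a * m c).
Proof.
by rewrite scaler_nat -sumrMnl; apply: eq_bigr => c _; rewrite -mulrnA mulnC.
Qed.

Lemma sum_mulrn_add (V : nmodType) (I : finType) (e : I -> V) (m m' : I -> nat) :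
  \sum_(c : I) e c *+ (m c + m' c) =
  (\sum_(c : I) e c *+ m c) + (\sum_(c : I) e c *+ m' c).
Proof. by rewrite -big_split; apply: eq_bigr => c _; rewrite mulrnDr. Qed.

Lemma coset_sumE (l n : nat) (gamma : int) :
  coset_sum l n gamma =
  \sum_(c : 'Z_n) ('qX : cyc_ring l n) ^+ c *+ (c \in cyc_coset l n gamma).
Proof.
by rewrite /coset_sum big_mkcond; apply: eq_bigr => c _; case: ifP.
Qed.

(** * Cyclotomic cosets *)

Lemma natr_Fp_eq (p a b : nat) : prime p ->
  (a%:R == b%:R :> 'F_p) = (a == b %[mod p]).
Proof. by move=> p_pr; rewrite -val_eqE /= !val_Fp_nat. Qed.

Lemma natr_Fp_eq0 (p a : nat) : prime p -> (a%:R == 0 :> 'F_p) = (p %| a)%N.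
Proof. by move=> p_pr; rewrite -[0]/(0%:R) natr_Fp_eq // mod0n. Qed.

Lemma totient_half (p s k : nat) : prime p -> p = (4 * k + 3)%N -> (0 < s)%N ->
  (totient (p ^ s) %/ 2 = (2 * k + 1) * p ^ s.-1)%N.
Proof.
move=> p_pr pE s0; rewrite totient_pfactor //.
have -> : p.-1 = ((2 * k + 1) * 2)%N by lia.
by rewrite mulnAC mulnK.
Qed.

(** The exponent is (2k+1) p^(s-1), and x^p = x in F_p, so modulo p this is Euler's criterion; the
    work lies in lifting the congruence from p to p^s. *)
Lemma is_res_order (p s k a : nat) :
    prime p -> p = (4 * k + 3)%N -> (0 < s)%N -> coprime a p ->
  (a ^ (totient (p ^ s) %/ 2) == 1 %[mod p ^ s])%N = is_res (a%:R : 'F_p).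
Proof.
move=> p_pr pE s0 a_co; have p1 := prime_gt1 p_pr.
have exp_p e (x : 'F_p) : x ^+ (p ^ e) = x.
  elim: e => [|e IH]; rewrite ?expr1 // expnS exprM.
  by have := expf_card x; rewrite card_Fp // => ->.
have resE : is_res (a%:R : 'F_p) = (a ^ (totient (p ^ s) %/ 2) == 1 %[mod p])%N.
  rewrite -natr_Fp_eq // natrX (totient_half p_pr pE s0) exprM exp_p.
  rewrite /is_res card_Fp //; have -> // : p./2 = (2 * k + 1)%N by rewrite pE; lia.
rewrite resE; apply/idP/idP => [/eqP e|].
  have dp : (p %| p ^ s)%N by rewrite dvdn_exp.
  by rewrite -(modn_dvdm _ dp) e modn_dvdm.
set w := (a ^ _)%N => wp.
have w0 : (0 < w)%N.
  rewrite expn_gt0; case: (posnP a) a_co => // ->.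
  by rewrite /coprime gcd0n => /eqP e; move: p1; rewrite e.
(* [w] is a square root of 1 mod [p ^ s] and is 1 mod [p], hence
   [p ^ s %| (w - 1) * (w + 1)] with [w + 1] prime to [p]. *)
have ww : (w * w == 1 %[mod p ^ s])%N.
  rewrite -expnD addnn -mul2n mulnC divnK.
    by apply/eqP/Euler_exp_totient; rewrite coprimeXr.
  by rewrite totient_pfactor // dvdn_mulr // dvdn2; lia.
rewrite !eqn_mod_dvd ?muln_gt0 ?w0 // in ww wp *.
have fact : (w * w - 1 = (w - 1) * (w + 1))%N.
  by rewrite mulnn -(exp1n 2) subn_sqr.
rewrite fact Gauss_dvdl // in ww.
rewrite coprimeXl // prime_coprime //; apply/negP => d.
have : (p %| w + 1 - (w - 1))%N by rewrite dvdn_sub.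
have -> : (w + 1 - (w - 1) = 2)%N by lia.
by move/dvdn_leq; lia.
Qed.

Lemma dvdn_eq_mod (d N a b : nat) : (d %| N)%N -> a = b %[mod N] ->
  (d %| a)%N = (d %| b)%N.
Proof. by move=> dN ab; rewrite /dvdn -(modn_dvdm a dN) ab modn_dvdm. Qed.

Lemma gcdn_eq_mod (N a b : nat) : a = b %[mod N] -> gcdn a N = gcdn b N.
Proof. by move=> ab; rewrite -gcdn_modl ab gcdn_modl. Qed.

Section Cosets.
Variables (p q l s t k : nat).
Hypotheses (s_gt0 : (0 < s)%N) (t_gt0 : (0 < t)%N).
Hypotheses (p_pr : prime p) (q_pr : prime q) (neq_pq : p != q).
Hypothesis pE : p = (4 * k + 3)%N.
Hypothesis ord_p : mult_ord (p ^ s) l%:Z = (totient (p ^ s) %/ 2)%N.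
Hypothesis ord_q : mult_ord (q ^ t) l%:Z = totient (q ^ t).
Hypothesis gcd_phi : gcdn (totient (p ^ s)) (totient (q ^ t)) = 2%N.
Variable g : int.
Hypothesis g_p : primitive_root_mod (p ^ s) g.

Let n := (p ^ s * q ^ t)%N.

Let p0 : (0 < p)%N. Proof. exact: prime_gt0. Qed.
Let q0 : (0 < q)%N. Proof. exact: prime_gt0. Qed.
Let ps1 : (1 < p ^ s)%N.
Proof. by rewrite -(expn0 p) ltn_exp2l ?prime_gt1. Qed.
Let qt1 : (1 < q ^ t)%N.
Proof. by rewrite -(expn0 q) ltn_exp2l ?prime_gt1. Qed.
Let n1 : (1 < n)%N.
Proof. by rewrite /n (leq_trans ps1) // leq_pmulr // ltnW. Qed.
Let co_pq : coprime p q. Proof. by rewrite prime_coprime ?dvdn_prime2. Qed.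

Let ord_p_gt0 : (0 < mult_ord (p ^ s) l%:Z)%N.
Proof. by rewrite ord_p (totient_half p_pr pE) // muln_gt0 expn_gt0 p0 addn1. Qed.
Let ord_q_gt0 : (0 < mult_ord (q ^ t) l%:Z)%N.
Proof. by rewrite ord_q totient_gt0 expn_gt0 q0. Qed.

Let l_co_p : coprime l p.
Proof. by have := mult_ord_coprime ps1 ord_p_gt0; rewrite coprime_pexpr. Qed.
Let l_co_q : coprime l q.
Proof. by have := mult_ord_coprime qt1 ord_q_gt0; rewrite coprime_pexpr. Qed.

Let res_l : is_res (l%:R : 'F_p).
Proof. by rewrite -(is_res_order p_pr pE s_gt0) // mult_ord_dvd // ord_p. Qed.

Let cardFp : #|'F_p| = (4 * k + 3)%N. Proof. by rewrite card_Fp. Qed.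

(* [totient (p ^ s) %/ 2] is odd because [p = 3 %[mod 4]]. *)
Let co_ord : coprime (mult_ord (p ^ s) l%:Z) (mult_ord (q ^ t) l%:Z).
Proof.
have odd_m : odd (mult_ord (p ^ s) l%:Z).
  by rewrite ord_p (totient_half p_pr pE) // oddM oddX oddD oddM pE oddD oddM orbT.
suff : (gcdn (mult_ord (p ^ s) l%:Z) (mult_ord (q ^ t) l%:Z) %| 2)%N.
  rewrite dvdn_divisors // !inE /coprime => /orP[//|/eqP e].
  have := dvdn_gcdl (mult_ord (p ^ s) l%:Z) (mult_ord (q ^ t) l%:Z).
  by rewrite e dvdn2 odd_m.
  rewrite -gcd_phi dvdn_gcd ord_q dvdn_gcdr andbT ord_p.
  apply: dvdn_trans (dvdn_gcdl _ _) _; apply/dvdnP; exists 2%N.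
  by rewrite mulnC divnK // totient_pfactor // dvdn_mulr // dvdn2; lia.
Qed.

(** * Membership in a cyclotomic coset *)

Lemma cyc_coset_natP (gamma : nat) (c : 'Z_n) :
  (c \in cyc_coset l n gamma%:Z) <-> exists r, gamma * l ^ r = c %[mod n].
Proof.
have valE r : ((gamma%:Z * l%:Z ^+ r)%:~R : 'Z_n) = (gamma * l ^ r)%:R.
  by rewrite intrM natrM natrX rmorphXn.
have cE r : (c == (gamma * l ^ r)%:R) = (gamma * l ^ r == c %[mod n])%N.
  rewrite -val_eqE /= val_Zp_nat // eq_sym; congr (_ == _)%N.
  by rewrite modn_small // -[X in (_ < X)%N]Zp_cast.
split=> [/cyc_cosetP[r]|[r /eqP e]].
  by rewrite valE => /eqP; rewrite cE => /eqP ?; exists r.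
by apply/cyc_cosetP; exists r; apply/eqP; rewrite valE cE.
Qed.

(** Since i < s, the class of a / p^i modulo p depends only on a modulo p^s. *)
Lemma natr_Fp_divn_mod (i a b : nat) : (i < s)%N -> a = b %[mod p ^ s] ->
  (p ^ i %| a)%N -> (a %/ p ^ i)%:R = (b %/ p ^ i)%:R :> 'F_p.
Proof.
move=> si ab da; have db : (p ^ i %| b)%N.
  by rewrite -(dvdn_eq_mod _ ab) // dvdn_exp2l // ltnW.
move/eqP: ab; have -> : (p ^ s = p ^ i * (p ^ (s - i.+1) * p))%N.
  by rewrite -expnSr -expnD; congr (_ ^ _)%N; lia.
rewrite -{1}(divnK da) -{1}(divnK db) ![(_ %/ _ * _)%N]mulnC -!muln_modr.
rewrite eqn_pmul2l ?expn_gt0 ?p0 // => /eqP e; apply/eqP; rewrite natr_Fp_eq //.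
have dp : (p %| p ^ (s - i.+1) * p)%N by rewrite dvdn_mull.
by rewrite -(modn_dvdm (a %/ _) dp) e modn_dvdm.
Qed.

Let ps_dvd_n : (p ^ s %| n)%N. Proof. exact: dvdn_mulr. Qed.
Let qt_dvd_n : (q ^ t %| n)%N. Proof. exact: dvdn_mull. Qed.

Let co_ps_qt : coprime (p ^ s) (q ^ t).
Proof. by rewrite coprimeXl // coprimeXr. Qed.

Let eq_mod_n (a b : nat) :
  (a == b %[mod n])%N = (a == b %[mod p ^ s])%N && (a == b %[mod q ^ t])%N.
Proof. exact: chinese_remainder. Qed.

(** Necessity is read off modulo p^s and q^t. For sufficiency, an exponent is found for each
    modulus, determined modulo the order of l there; the two orders are coprime. *)
Lemma mem_coset (i j h : nat) (c : 'Z_n) :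
    (i <= s)%N -> (j <= t)%N -> coprime h p -> coprime h q ->
  (c \in cyc_coset l n (p ^ i * q ^ j * h)%N%:Z) =
  [&& p ^ i %| c, (i == s) || is_res ((q ^ j * h * (c %/ p ^ i))%:R : 'F_p)
    & gcdn c (q ^ t) == q ^ j]%N.
Proof.
move=> is_ jt hp hq.
have dps : (p ^ i %| p ^ s)%N by rewrite dvdn_exp2l.
have dqt : (q ^ j %| q ^ t)%N by rewrite dvdn_exp2l.
have qjh_co : coprime (q ^ j * h) p by rewrite coprimeMl coprimeXl // coprime_sym.
have pih_co : coprime (p ^ i * h) q by rewrite coprimeMl coprimeXl.
have qjh_neq0 : (q ^ j * h)%:R != 0 :> 'F_p.
  by rewrite natr_Fp_eq0 // -prime_coprime // coprime_sym.
apply/idP/and3P=> [/cyc_coset_natP[r e]|[]].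
  have ep : (p ^ i * (q ^ j * h * l ^ r))%N = c %[mod p ^ s].
    by rewrite !mulnA -(modn_dvdm _ ps_dvd_n) e modn_dvdm.
  have eq : (q ^ j * (p ^ i * h * l ^ r))%N = c %[mod q ^ t].
    by rewrite !mulnA (mulnC (q ^ j)%N) -(modn_dvdm _ qt_dvd_n) e modn_dvdm.
  split.
  - by rewrite -(dvdn_eq_mod dps ep) dvdn_mulr.
  - have [//|] := eqVneq i s; rewrite neq_ltn (ltnNge s) is_ orbF => i_s /=.
    have pi_gt0 : (0 < p ^ i)%N by rewrite expn_gt0 p0.
    (* The argument of the character becomes (q^j h)^2 l^r, a residue because l is one. *)
    rewrite natrM -(natr_Fp_divn_mod i_s ep) ?dvdn_mulr // mulKn //.
    rewrite [X in _ * X]natrM mulrA is_resMl ?(is_res_sqr cardFp) // natrX.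
    by rewrite /is_res exprAC (eqP res_l) expr1n.
  - rewrite -(gcdn_eq_mod eq) gcdnC Gauss_gcdl ?(gcdn_idPr dqt) //.
    by rewrite coprimeXl // coprime_sym coprimeMl pih_co coprimeXl.
move=> dc res_c gcd_c.
have [r1 r1P] : exists r1, forall r, r = r1 %[mod mult_ord (p ^ s) l%:Z] ->
    p ^ i * (q ^ j * h * l ^ r) = c %[mod p ^ s].
  have [iE|neq_is] := eqVneq i s.
    (* For i = s both sides vanish modulo p^s and every exponent works. *)
    by exists 0%N => r _; rewrite iE in dc *; rewrite modnMr (eqP dc).
  have i_s : (i < s)%N by rewrite ltn_neqAle neq_is.
  rewrite (negPf neq_is) /= natrM in res_c.
  have [] := mult_ord_solve (c := (c %/ p ^ i)%N)
    ps1 ord_p_gt0 g_p (z := (q ^ j * h)%N).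
  - by rewrite coprimeXr.
  - move=> y zy; rewrite ord_p; apply/eqP.
    have zyF : (q ^ j * h)%:R * y%:R = (c %/ p ^ i)%:R :> 'F_p.
      apply/eqP; rewrite -natrM natr_Fp_eq //; apply/eqP.
      rewrite -(modn_dvdm (_ * y) (dvdn_exp s_gt0 (dvdnn p))) zy.
      by rewrite modn_dvdm ?dvdn_exp.
    (* With z = q^j h and c / p^i = z y, the character condition concerns z^2 y, so y is a
       residue. *)
    rewrite -zyF mulrA is_resMl ?(is_res_sqr cardFp) // in res_c.
    rewrite (is_res_order p_pr pE) //.
    rewrite coprime_sym prime_coprime // -natr_Fp_eq0 //.
    exact: (is_res_neq0 cardFp res_c).
  move=> r0 r0P; exists r0 => r /r0P e.
  by rewrite -modnMmr e modnMmr mulnC divnK.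
have [r2 r2P] : exists r2, forall r, r = r2 %[mod mult_ord (q ^ t) l%:Z] ->
    q ^ j * (p ^ i * h * l ^ r) = c %[mod q ^ t].
  have [jE|neq_jt] := eqVneq j t.
    exists 0%N => r _; rewrite jE in gcd_c *.
    by rewrite modnMr; apply/esym/eqP/gcdn_idPr/eqP.
  have j_t : (j < t)%N by rewrite ltn_neqAle neq_jt.
  move: gcd_c; rewrite gcdn_pfactor_eq // => /andP[dqc ndqc].
  (* By [ord_q], l itself serves as the primitive root modulo q^t. *)
  have [] := mult_ord_solve (c := (c %/ q ^ j)%N)
    qt1 ord_q_gt0 ord_q (z := (p ^ i * h)%N).
  - by rewrite coprimeXr.
  - move=> y /gcdn_eq_mod zy; rewrite ord_q; apply: Euler_exp_totient.
    have : coprime (p ^ i * h * y) (q ^ t).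
      rewrite /coprime zy -/(coprime _ _) coprimeXr // coprime_sym prime_coprime //.
      apply: contra ndqc => d; rewrite -(divnK dqc) expnS.
      by rewrite dvdn_pmul2r ?expn_gt0 ?q0.
    by rewrite coprimeMl => /andP[].
  move=> r0 r0P; exists r0 => r /r0P e.
  by rewrite -modnMmr e modnMmr mulnC divnK.
apply/cyc_coset_natP.
exists (chinese (mult_ord (p ^ s) l) (mult_ord (q ^ t) l) r1 r2).
apply/eqP; rewrite eq_mod_n; apply/andP; split; apply/eqP.
  by rewrite -!mulnA; rewrite !(mulnA (q ^ j)%N) r1P // chinese_modl.
by rewrite (mulnC (p ^ i)%N) -!mulnA !(mulnA (p ^ i)%N) r2P // chinese_modr.
Qed.

(** * Counting the representations of c as a sum from two cosets *)

Let sum_Zn (F : nat -> nat) : (\sum_(b : 'Z_n) F b = \sum_(0 <= b < n) F b)%N.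
Proof. by rewrite -(big_mkord xpredT F) Zp_cast. Qed.

Let sum_Fp (f : 'F_p -> nat) :
  (\sum_(0 <= y < p) f y%:R = \sum_(x : 'F_p) f x)%N.
Proof.
rewrite -{1}(Fp_cast p_pr) big_mkord; apply: eq_bigr => x _.
by rewrite natr_Zp.
Qed.

(** As j < j', q^(j+1) divides b, so c - b and c have gcd q^j with q^t simultaneously; likewise p^i
    divides b, hence c - b exactly when c. The conditions on c alone thus factor out. *)
Lemma mem_cosetD (i j j' : nat) (c b : 'Z_n) :
    (i < s)%N -> (j < j')%N -> (j' <= t)%N ->
  ((b \in cyc_coset l n (p ^ i * q ^ j')%N%:Z) *
   (c - b \in cyc_coset l n (p ^ i * q ^ j)%N%:Z)%R =
   ((p ^ i %| c) && (gcdn c (q ^ t) == q ^ j)) *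
   ((p ^ i %| b) * (is_res ((q ^ j')%:R * (b %/ p ^ i)%:R : 'F_p)%R &&
     is_res ((q ^ j)%:R * ((c %/ p ^ i)%:R - (b %/ p ^ i)%:R) : 'F_p)%R) *
    (gcdn b (q ^ t) == q ^ j')))%N.
Proof.
move=> i_s jj' j't; have jt := leq_trans jj' j't.
rewrite -(muln1 (p ^ i * q ^ j')%N) -(muln1 (p ^ i * q ^ j)%N).
have co1 r : coprime 1 r by rewrite coprime1n.
set d : 'Z_n := (c - b)%R.
have cE : b + d = c %[mod n].
  have -> : c = (b + d)%R by rewrite addrC subrK.
  by rewrite /=; move: (b + d)%N => m; rewrite Zp_cast // modn_mod.
clearbody d.
rewrite !mem_coset ?co1 ?(ltnW i_s) ?(ltnW jt) // (ltn_eqF i_s) /= !muln1.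
have cEq (N : nat) : (N %| n)%N -> b + d = c %[mod N].
  by move=> Nn; rewrite -(modn_dvdm _ Nn) cE modn_dvdm.
have pi_ps : (p ^ i %| p ^ s)%N by rewrite dvdn_exp2l // ltnW.
have [db|] := boolP (p ^ i %| b)%N; last by rewrite !mul0n muln0.
have dE : (p ^ i %| d)%N = (p ^ i %| c)%N.
  by rewrite -(dvdn_eq_mod pi_ps (cEq _ ps_dvd_n)) dvdn_addr.
rewrite dE mul1n /=; have [dc|] := boolP (p ^ i %| c)%N; last by rewrite muln0.
have -> : (c %/ p ^ i)%:R = (b %/ p ^ i)%:R + (d %/ p ^ i)%:R :> 'F_p.
  rewrite -(natr_Fp_divn_mod i_s (cEq _ ps_dvd_n)) ?dvdn_addr ?dE //.
  by rewrite divnDl // natrD.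
rewrite addrAC subrr add0r -!natrM.
have [gb|] := eqVneq (gcdn b (q ^ t)) (q ^ j')%N; last by rewrite !andbF !muln0.
have dqb e : (e <= j')%N -> (q ^ e %| b)%N.
  by move=> ej; apply: dvdn_trans (dvdn_exp2l q ej) _; rewrite -gb dvdn_gcdl.
have dqd e : (e <= j')%N -> (q ^ e %| d)%N = (q ^ e %| c)%N.
  move=> ej; have qe : (q ^ e %| q ^ t)%N by rewrite dvdn_exp2l // (leq_trans ej).
  by rewrite -(dvdn_eq_mod qe (cEq _ qt_dvd_n)) dvdn_addr ?dqb.
rewrite !gcdn_pfactor_eq // !dqd ?(ltnW jj') // !andbT.
rewrite /= muln1; do 2 case: is_res; by do 2 case: (_ %| c)%N.
Qed.

Lemma count_coset_sum (i j j' : nat) (c : 'Z_n) :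
    (i < s)%N -> (j < j')%N -> (j' <= t)%N ->
  (\sum_(b : 'Z_n) (b \in cyc_coset l n (p ^ i * q ^ j')%N%:Z) *
     (c - b \in cyc_coset l n (p ^ i * q ^ j)%N%:Z)%R =
   ((p ^ i %| c) && (gcdn c (q ^ t) == q ^ j)) *
   (p ^ (s - i - 1) *
    (\sum_(x : 'F_p) (is_res ((q ^ j')%:R * x)%R &&
       is_res ((q ^ j)%:R * ((c %/ p ^ i)%:R - x))%R)) *
    totient (q ^ (t - j'))))%N.
Proof.
move=> i_s jj' j't; under eq_bigr do rewrite mem_cosetD //.
rewrite -big_distrr /=; congr (_ * _)%N.
pose f (x : 'F_p) : nat := is_res ((q ^ j')%:R * x)%R &&
  is_res ((q ^ j)%:R * ((c %/ p ^ i)%:R - x))%R.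
pose F (x : nat) := ((p ^ i %| x) * f (x %/ p ^ i)%:R)%N.
pose G (y : nat) : nat := (gcdn y (q ^ t) == q ^ j')%N.
have pi_ps : (p ^ i %| p ^ s)%N by rewrite dvdn_exp2l // ltnW.
transitivity (\sum_(b : 'Z_n) F (b %% p ^ s) * G (b %% q ^ t))%N.
  apply: eq_bigr => b _; rewrite {}/F {}/G gcdn_modl; congr (_ * _)%N.
  have bE : b = (b %% p ^ s)%N %[mod p ^ s] by rewrite modn_mod.
  rewrite -(dvdn_eq_mod pi_ps bE); have [db|//] := boolP (p ^ i %| b)%N.
  by rewrite /f -(natr_Fp_divn_mod i_s bE).
rewrite (sum_Zn (fun b => F (b %% p ^ s) * G (b %% q ^ t))%N).
rewrite sum_nat_chinese // sum_nat_gcd //; congr (_ * _)%N.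
(* The factor p^i selects the multiples b = p^i y; then y runs through each class modulo p exactly
   p^(s-i-1) times. *)
have -> : (p ^ s = p ^ (s - i - 1) * p * p ^ i)%N.
  by rewrite -expnSr -expnD; congr (_ ^ _)%N; lia.
rewrite (sum_nat_dvd _ (fun y => f y%:R)) ?expn_gt0 ?p0 // -sum_Fp.
rewrite -sum_nat_mod; apply: eq_bigr => y _.
by rewrite Fp_nat_mod.
Qed.
(* [h] stands for the least nonnegative residue of [g] modulo [n]. *)
Variable h : nat.
Hypotheses (h_co_p : coprime h p) (h_co_q : coprime h q).
Hypothesis res_Nh : is_res (- h%:R : 'F_p).

(** * Coset indicators as character conditions *)

Lemma mem_chi (i j : nat) (c : 'Z_n) : (i < s)%N -> (j <= t)%N ->
  (c \in cyc_coset l n (p ^ i * q ^ j)%N%:Z) =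
  [&& p ^ i %| c, is_res ((q ^ j)%:R * (c %/ p ^ i)%:R : 'F_p)%R
    & gcdn c (q ^ t) == q ^ j]%N.
Proof.
move=> i_s jt; rewrite -(muln1 (p ^ i * q ^ j)%N).
by rewrite mem_coset ?coprime1n ?(ltnW i_s) // (ltn_eqF i_s) /= muln1 natrM.
Qed.

(** As -h is a residue, the extra factor h reverses the character. *)
Lemma mem_chi_star (i j : nat) (c : 'Z_n) : (i < s)%N -> (j <= t)%N ->
  (c \in cyc_coset l n (p ^ i * q ^ j * h)%N%:Z) =
  [&& p ^ i %| c, is_res (- ((q ^ j)%:R * (c %/ p ^ i)%:R) : 'F_p)%R
    & gcdn c (q ^ t) == q ^ j]%N.
Proof.
move=> i_s jt; rewrite mem_coset ?(ltnW i_s) // (ltn_eqF i_s) /=.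
by rewrite (mulnC (q ^ j)%N) -mulnA natrM is_resMlN // natrM.
Qed.

Let qX_neq0 j : (q ^ j)%:R != 0 :> 'F_p.
Proof. by rewrite natr_Fp_eq0 // -prime_coprime // coprimeXr. Qed.

(** If p^m exactly divides c with m < s, then c meets the character condition of exactly one of the
    two cosets at level m, and of none at another level. The induction descends from level s, which
    collects the multiples of p^s. *)
Lemma sum_mem_chi (i j : nat) (c : 'Z_n) : (i <= s)%N -> (j <= t)%N ->
  (\sum_(i <= m < s) ((c \in cyc_coset l n (p ^ m * q ^ j)%N%:Z) +
     (c \in cyc_coset l n (p ^ m * q ^ j * h)%N%:Z)) +
   (c \in cyc_coset l n (p ^ s * q ^ j)%N%:Z) =
   (p ^ i %| c) && (gcdn c (q ^ t) == q ^ j))%N.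
Proof.
move=> is_ jt; rewrite -(subKn is_).
elim: (s - i)%N (leq_subr i s) => [|e IH] es.
  rewrite subn0 big_geq // -(muln1 (p ^ s * q ^ j)%N) mem_coset ?coprime1n //.
  by rewrite eqxx.
have lt_es : (s - e.+1 < s)%N by rewrite ltn_subrL s_gt0.
rewrite big_ltn // -addnA subnSK //.
rewrite IH; last exact: ltnW.
rewrite mem_chi // mem_chi_star //.
have <- : (s - e.+1).+1 = (s - e)%N by rewrite subnSK.
set m := (s - e.+1)%N; have [dc|ndc] := boolP (p ^ m %| c)%N; last first.
  suff /negPf-> : ~~ (p ^ m.+1 %| c)%N by [].
  by apply: contra ndc => d; apply: dvdn_trans (dvdn_exp2l p (leqnSn m)) d.
case: (gcdn c (q ^ t) == _)%N; last by rewrite !andbF.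
rewrite !andbT /= (is_res_sign cardFp) mulf_eq0 (negPf (qX_neq0 j)) /=.
rewrite natr_Fp_eq0 // dvdn_divRL // -expnS.
by case: dvdn.
Qed.

(** * Product formulas for coset sums *)

Let X i j := coset_sum l n (p ^ i * q ^ j)%N%:Z.
Let X' i j := coset_sum l n (p ^ i * q ^ j * h)%N%:Z.

Let XM i j j' : (i < s)%N -> (j < j')%N -> (j' <= t)%N ->
  X i j * X i j' = \sum_(c : 'Z_n) 'qX ^+ c *+
    ((p ^ i %| c) && (gcdn c (q ^ t) == q ^ j) *
     (p ^ (s - i - 1) *
      (\sum_(x : 'F_p) (is_res ((q ^ j')%:R * x)%R &&
         is_res ((q ^ j)%:R * ((c %/ p ^ i)%:R - x))%R)) *
      totient (q ^ (t - j'))))%N.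
Proof.
move=> i_s jj' j't; rewrite mul_set_sums ?qX_expn //.
by apply: eq_bigr => c _; rewrite count_coset_sum.
Qed.

Lemma coset_sum_mul_same (i j j' : nat) :
    (i < s)%N -> (j < j')%N -> (j' <= t)%N ->
    is_res ((q ^ j)%:R * (q ^ j')%:R : 'F_p) ->
  X i j * X i j' =
    (k * p ^ (s - i - 1) * totient (q ^ (t - j')))%N%:R *: X i j
  + ((k + 1) * p ^ (s - i - 1) * totient (q ^ (t - j')))%N%:R *: X' i j.
Proof.
move=> i_s jj' j't res_qq; have jt := ltnW (leq_trans jj' j't).
rewrite XM // /X /X' !coset_sumE !scale_sum_mulrn -sum_mulrn_add.
apply: eq_bigr => c _; congr (_ *+ _).
rewrite (sum_res_same cardFp) // mem_chi // mem_chi_star //.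
case: (_ %| c)%N; last by rewrite !muln0.
case: (gcdn c (q ^ t) == _)%N; last by rewrite !andbF !muln0.
by rewrite /= !andbT mul1n; ring.
Qed.

(** The count in F_p is k when c / p^i is nonzero modulo p and 2k+1 when p^(i+1) divides c; in the
    second case (2k+1) p^(s-i-1) is phi(p^(s-i))/2. *)
Lemma coset_sum_mul_opp (i j j' : nat) :
    (i < s)%N -> (j < j')%N -> (j' <= t)%N ->
    is_res (- ((q ^ j)%:R * (q ^ j')%:R) : 'F_p) ->
  X i j * X i j' =
    (k * p ^ (s - i - 1) * totient (q ^ (t - j')))%N%:R *: (X i j + X' i j)
  + (totient (p ^ (s - i)) %/ 2 * totient (q ^ (t - j')))%N%:R
      *: (\sum_(i.+1 <= m < s) (X m j + X' m j) + X s j).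
Proof.
move=> i_s jj' j't res_qq; have jt := ltnW (leq_trans jj' j't).
(* These cosets together consist of the c with p^(i+1) | c and gcd(c, q^t) = q^j, each taken
   once. *)
have -> : \sum_(i.+1 <= m < s) (X m j + X' m j) + X s j =
    \sum_(c : 'Z_n) 'qX ^+ c *+ ((p ^ i.+1 %| c) && (gcdn c (q ^ t) == q ^ j))%N.
  under eq_bigr do rewrite /X /X' !coset_sumE -sum_mulrn_add.
  rewrite exchange_big /= /X coset_sumE -big_split /=.
  by apply: eq_bigr => c _; rewrite sumrMnr -mulrnDr sum_mem_chi.
rewrite XM // /X /X' !coset_sumE -sum_mulrn_add !scale_sum_mulrn -sum_mulrn_add.
apply: eq_bigr => c _; congr (_ *+ _).
rewrite (sum_res_opp cardFp) // mem_chi // mem_chi_star //.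
rewrite (totient_half p_pr pE) ?subn_gt0 // -subn1.
have [dc|ndc] := boolP (p ^ i %| c)%N; last first.
  suff /negPf-> : ~~ (p ^ i.+1 %| c)%N by rewrite !muln0.
  by apply: contra ndc => d; apply: dvdn_trans (dvdn_exp2l p (leqnSn i)) d.
case: (gcdn c (q ^ t) == _)%N; last by rewrite !andbF !muln0.
rewrite !andbT /= (is_res_sign cardFp) mulf_eq0 (negPf (qX_neq0 j)) /=.
rewrite natr_Fp_eq0 // dvdn_divRL // -expnS.
by case: dvdn; rewrite /= ?muln0 ?muln1 ?addn0 ?add0n mul1n; ring.
Qed.

End Cosets.

(** * Quadratic residues modulo p and conclusion *)

Lemma quad_residue_is_res (p a k : nat) : prime p -> p = (4 * k + 3)%N ->
  quad_residue p a -> is_res (a%:R : 'F_p).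
Proof.
move=> p_pr pE [a_co [x xa]].
have cardFp : #|'F_p| = (4 * k + 3)%N by rewrite card_Fp.
have aE : a%:R = x%:R * x%:R :> 'F_p.
  by rewrite -natrM mulnn; apply/eqP; rewrite natr_Fp_eq // xa.
rewrite aE (is_res_sqr cardFp) //; apply: contraTneq a_co => x0.
by rewrite coprime_sym prime_coprime // -natr_Fp_eq0 // aE x0 mul0r eqxx.
Qed.

(* As p = 4k + 3, if a^(2k+1) = 1 mod p then a^(k+1) is a square root of a. *)
Lemma quad_nonresidue_is_res (p a k : nat) : prime p -> p = (4 * k + 3)%N ->
  quad_nonresidue p a -> is_res (- a%:R : 'F_p).
Proof.
move=> p_pr pE [a_co nres].
have cardFp : #|'F_p| = (4 * k + 3)%N by rewrite card_Fp.
rewrite (is_resN cardFp); last first.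
  by rewrite natr_Fp_eq0 // -prime_coprime // coprime_sym.
apply/negP; rewrite /is_res cardFp => res_a; apply: nres.
exists (a ^ k.+1)%N; apply/eqP; rewrite -natr_Fp_eq // -expnM natrX.
have -> : (k.+1 * 2 = ((4 * k + 3)./2).+1)%N by lia.
by rewrite exprS (eqP res_a) mulr1.
Qed.

Lemma coset_sum_modz (l n a : nat) (g : int) : (1 < n)%N ->
  coset_sum l n (a%:Z * g) = coset_sum l n (a * `|(g %% n)%Z|)%N%:Z.
Proof.
move=> n1; rewrite /coset_sum /cyc_coset.
suff -> : ((a * `|(g %% n)%Z|)%N%:Z)%:~R = (a%:Z * g)%:~R :> 'Z_n by [].
rewrite PoszM gez0_abs ?modz_ge0 -?lt0n ?(ltnW n1) //.
by rewrite intrM [RHS]intrM intr_modz.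
Qed.

Theorem theorem4p8 (s t p q l : nat) (g : int)
    (hs : (1 <= s)%N) (ht : (1 <= t)%N)
    (p_prime : prime p) (q_prime : prime q) (l_prime : prime l)
    (hpq : p != q) (hpl : p != l) (hql : q != l)
    (p_odd : odd p) (q_odd : odd q)
    (p_mod4 : p = 3 %[mod 4])
    (ord_p : mult_ord (p ^ s) l%:Z = (totient (p ^ s) %/ 2)%N)
    (ord_q : mult_ord (q ^ t) l%:Z = totient (q ^ t))
    (gcd_phi : gcdn (totient (p ^ s)) (totient (q ^ t)) = 2%N)
    (g_p : primitive_root_mod (p ^ s) g)
    (g_q : primitive_root_mod (q ^ t) g)
    (i j j' : nat)
    (hi : (i <= s - 1)%N) (hjj' : (j < j')%N) (hj' : (j' <= t)%N) :
  let X := chi p q l s t in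
  let X' := chi_star p q l s t g in
  [/\ quad_residue p q ->
        X i j * X i j' =
          ((p - 3) %/ 4 * p ^ (s - i - 1) * totient (q ^ (t - j')))%N%:R *: X i j
        + ((p + 1) %/ 4 * p ^ (s - i - 1) * totient (q ^ (t - j')))%N%:R *: X' i j,
      quad_nonresidue p q -> (2 %| j' - j)%N ->
        X i j * X i j' =
          ((p - 3) %/ 4 * p ^ (s - i - 1) * totient (q ^ (t - j')))%N%:R *: X i j
        + ((p + 1) %/ 4 * p ^ (s - i - 1) * totient (q ^ (t - j')))%N%:R *: X' i j
    & quad_nonresidue p q -> ~~ (2 %| j' - j)%N ->
        X i j * X i j' =
          ((p - 3) %/ 4 * p ^ (s - i - 1) * totient (q ^ (t - j')))%N%:R
            *: (X i j + X' i j)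
        + (totient (p ^ (s - i)) %/ 2 * totient (q ^ (t - j')))%N%:R
            *: (\sum_(i.+1 <= k < s) (X k j + X' k j) + X s j)].
Proof.
move=> X X'; pose n := (p ^ s * q ^ t)%N; pose k := (p %/ 4)%N.
have pE : p = (4 * k + 3)%N by rewrite {1}(divn_eq p 4) p_mod4 mulnC.
have cardFp : #|'F_p| = (4 * k + 3)%N by rewrite card_Fp.
have p_gt0 := prime_gt0 p_prime; have q_gt0 := prime_gt0 q_prime.
have ps_gt1 : (1 < p ^ s)%N by rewrite -(expn0 p) ltn_exp2l ?prime_gt1.
have qt_gt1 : (1 < q ^ t)%N by rewrite -(expn0 q) ltn_exp2l ?prime_gt1.
have n_gt1 : (1 < n)%N by rewrite (leq_trans ps_gt1) // leq_pmulr // ltnW.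
pose h := `|(g %% n)%Z|%N.
have hE : h%:Z = (g %% n)%Z by rewrite gez0_abs ?modz_ge0 -?lt0n ?(ltnW n_gt1).
have ord_hp : mult_ord (p ^ s) h%:Z = totient (p ^ s).
  by rewrite hE mult_ord_modz ?dvdn_mulr.
have ord_hq : mult_ord (q ^ t) h%:Z = totient (q ^ t).
  by rewrite hE mult_ord_modz ?dvdn_mull.
have tot_p : (0 < totient (p ^ s))%N by rewrite totient_gt0 ltnW.
have tot_q : (0 < totient (q ^ t))%N by rewrite totient_gt0 ltnW.
have h_co_p : coprime h p.
  by have := @mult_ord_coprime (p ^ s) h; rewrite ord_hp coprime_pexpr //; apply.
have h_co_q : coprime h q.
  by have := @mult_ord_coprime (q ^ t) h; rewrite ord_hq coprime_pexpr //; apply.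
have res_Nh : is_res (- h%:R : 'F_p).
  rewrite (is_resN cardFp); last first.
    by rewrite natr_Fp_eq0 // -prime_coprime // coprime_sym.
  (* Were h a residue, its order phi(p^s) would divide phi(p^s)/2, which is positive and smaller. *)
  rewrite -(is_res_order p_prime pE hs h_co_p) mult_ord_dvd ?ord_hp //.
  rewrite gtnNdvd ?ltn_Pdiv // (totient_half p_prime pE hs).
  by rewrite muln_gt0 expn_gt0 p_gt0 addn1.
have i_s : (i < s)%N by rewrite -(subnK hs) addn1 ltnS.
have X'E a b : X' a b = coset_sum l n (p ^ a * q ^ b * h)%N%:Z.
  exact: coset_sum_modz.
have k1 : ((p - 3) %/ 4 = k)%N by lia.
have k2 : ((p + 1) %/ 4 = k + 1)%N by lia.
have q_neq0 : q%:R != 0 :> 'F_p by rewrite natr_Fp_eq0 // dvdn_prime2.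
(* Cases (i) and (ii) share this formula: q^(j+j') is a residue if q is one or if j + j' is even. *)
have same : is_res ((q ^ j)%:R * (q ^ j')%:R : 'F_p) -> X i j * X i j' =
    ((p - 3) %/ 4 * p ^ (s - i - 1) * totient (q ^ (t - j')))%N%:R *: X i j
  + ((p + 1) %/ 4 * p ^ (s - i - 1) * totient (q ^ (t - j')))%N%:R *: X' i j.
  rewrite k1 k2 X'E; apply: (coset_sum_mul_same hs ht) => //; exact: g_p.
split=> [q_res|q_nres|q_nres].
- apply: same; rewrite -natrM -expnD natrX.
  by rewrite /is_res exprAC (eqP (quad_residue_is_res p_prime pE q_res)) expr1n.
- move=> even_jj'; apply: same; rewrite -natrM -expnD.
  have -> : (j + j' = (j + j')./2 + (j + j')./2)%N by lia.
  by rewrite expnD natrM natrX (is_res_sqr cardFp) // expf_neq0.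
move=> odd_jj'; rewrite k1; under eq_bigr do rewrite X'E; rewrite X'E.
apply: (coset_sum_mul_opp hs ht) => //; first exact: g_p.
rewrite -natrM -expnD.
(* For odd j + j', q^(j+j') is a square times q, so the sign passes to q and -q is a residue. *)
have -> : (j + j' = ((j + j')./2 + (j + j')./2).+1)%N by lia.
rewrite expnSr expnD !natrM natrX -mulrN.
rewrite is_resMl ?(is_res_sqr cardFp) ?expf_neq0 //.
exact: quad_nonresidue_is_res pE q_nres.
Qed.
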